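(* Let $\mathbb{H}=\{e,-e,i,-i,j,-j,k,-k\}$ be the group of Hamiltonian quaternions (the quaternion group of order $8$). Every proper subgroup of $\mathbb{H}$ is abelian.
   Context: The group $\mathbb{H}$ has identity $e$ and multiplication determined by $i^2=j^2=k^2=-e$, $ij=-ji=k$, $jk=-kj=i$, $ki=-ik=j$, with $-e$ central and $(-e)^2=e$. *)

(* Defs.v *)
From HB Require Import structures.
From mathcomp Require Import all_boot all_fingroup all_solvable.

Set Implicit Arguments.
Unset Strict Implicit.
Unset Printing Implicit Defensive.

Local Open Scope group_scope.

Inductive quat_unit := Ue | Ui | Uj | Uk.

Definition bool2_of_quat_unit (u : quat_unit) : bool * bool :=
  match u with
  | Ue => (false, false) | Ui => (true, false)
  | Uj => (false, true)  | Uk => (true, true)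
  end.

Definition quat_unit_of_bool2 (b : bool * bool) : quat_unit :=
  match b with
  | (false, false) => Ue | (true, false) => Ui
  | (false, true) => Uj  | (true, true) => Uk
  end.

Lemma bool2_of_quat_unitK : cancel bool2_of_quat_unit quat_unit_of_bool2.
Proof. by case. Qed.

HB.instance Definition _ := Finite.copy quat_unit (can_type bool2_of_quat_unitK).

(* (s, u) stands for u when s = false and for -u when s = true. *)
Definition quat8 : Type := (bool * quat_unit)%type.

HB.instance Definition _ := Finite.on quat8.

Definition quat_unit_mul (u v : quat_unit) : quat8 :=
  match u, v with
  | Ue, _ => (false, v)
  | _, Ue => (false, u)
  | Ui, Ui | Uj, Uj | Uk, Uk => (true, Ue)
  | Ui, Uj => (false, Uk)
  | Uj, Ui => (true, Uk)
  | Uj, Uk => (false, Ui)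
  | Uk, Uj => (true, Ui)
  | Uk, Ui => (false, Uj)
  | Ui, Uk => (true, Uj)
  end.

Definition quat_mul (x y : quat8) : quat8 :=
  let: (s, w) := quat_unit_mul x.2 y.2 in (x.1 (+) y.1 (+) s, w).

Definition quat_one : quat8 := (false, Ue).

(* i^-1 = -i, and likewise for j and k, while e and -e are involutive. *)
Definition quat_inv (x : quat8) : quat8 :=
  (if x.2 is Ue then x.1 else ~~ x.1, x.2).

Lemma quat_mulA : associative quat_mul.
Proof. by move=> [[] []] [[] []] [[] []]. Qed.

Lemma quat_mul1 : left_id quat_one quat_mul.
Proof. by move=> [[] []]. Qed.

Lemma quat_mulV : left_inverse quat_one quat_inv quat_mul.
Proof. by move=> [[] []]. Qed.

HB.instance Definition _ :=
  Finite_isGroup.Build quat8 quat_mulA quat_mul1 quat_mulV.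

Definition Qe : quat8 := (false, Ue).
Definition Qme : quat8 := (true, Ue).
Definition Qi : quat8 := (false, Ui).
Definition Qmi : quat8 := (true, Ui).
Definition Qj : quat8 := (false, Uj).
Definition Qmj : quat8 := (true, Uj).
Definition Qk : quat8 := (false, Uk).
Definition Qmk : quat8 := (true, Uk).

Lemma quat8_setT :
  [set: quat8] = [set Qe; Qme; Qi; Qmi; Qj; Qmj; Qk; Qmk].
Proof. by apply/setP=> -[[] []]; rewrite !inE. Qed.

Lemma card_quat8 : #|[set: quat8]| = 8.
Proof.
by rewrite cardsT card_prod card_bool (bij_eq_card
  (Bijective bool2_of_quat_unitK (_ : cancel quat_unit_of_bool2 _)))
  ?card_prod ?card_bool // => -[[] []].
Qed.

Lemma quat8_relations :
  [/\ [/\ Qe = 1, Qme * Qme = Qe & forall x, Qme * x = x * Qme],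
      [/\ Qi * Qi = Qme, Qj * Qj = Qme & Qk * Qk = Qme],
      [/\ Qi * Qj = Qk, Qj * Qk = Qi & Qk * Qi = Qj],
      [/\ Qj * Qi = Qmk, Qk * Qj = Qmi & Qi * Qk = Qmj] &
      [/\ Qmi = Qme * Qi, Qmj = Qme * Qj & Qmk = Qme * Qk]].
Proof. by do !split=> //; move=> [[] []]. Qed.

Lemma quat8_isog_Q8 : [set: quat8] \isog 'Q_8.
Proof.
apply/(isoGrpP _ (@Grp_quaternion 3 isT)); split.
  by rewrite card_quat8 (@card_quaternion 3).
apply/existsP; exists (Qi, Qj); rewrite /= !xpair_eqE.
apply/and4P; split=> //.
apply/eqP/setP=> x; rewrite !inE.
set G := _ <*> _.
have Gi : Qi \in G by apply: (subsetP (joing_subl _ _)); apply: cycle_id.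
have Gj : Qj \in G by apply: (subsetP (joing_subr _ _)); apply: cycle_id.
have Gme : Qme \in G by rewrite (_ : Qme = Qi * Qi) // groupM.
have Gk : Qk \in G by rewrite (_ : Qk = Qi * Qj) // groupM.
have GN y : y \in G -> Qme * y \in G by apply: groupM.
case: x => [[] []] //.
- by apply: (GN _ Gi).
- by apply: (GN _ Gj).
- by apply: (GN _ Gk).
- by apply: (group1 G).
Qed.

(* Main.v *)
Require Import Defs.
From mathcomp Require Import all_boot all_fingroup all_solvable.

(** The whole group has order 2^3, so a proper subgroup is a 2-group of order at most 2^2, and every
    group of order p^n with n <= 2 is abelian ([p2group_abelian]). Only the order matters, not the
    multiplication table. *)

Theorem mainTheorem1 (G : {group quat8}) (hG : G \proper [set: quat8]) :
  abelian G.
Proof.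
have pQ : (2.-group [set: quat8])%g by rewrite /pgroup card_quat8.
have pG : (2.-group G)%g := pgroupS (proper_sub hG) pQ.
apply: (p2group_abelian pG).
have := proper_card hG.
(* Comparing exponents in 2^n < 2^3, where #|G| = 2^n, gives n < 3, that is n <= 2. The [{1}] keeps
   the #|G| inside [logn] intact. *)
by rewrite card_quat8 {1}(card_pgroup pG) -[8]/(2 ^ 3) ltn_exp2l.
Qed.
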